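(* If $X$ is a hereditarily Baire space and $Y$ is a topological space, then every $\sigma$-regular map $f:X\to Y$ is barely continuous.
   Context: A space is hereditarily Baire if each of its closed subspaces is a Baire space. A map $f:X\to Y$ is barely continuous if for every non-empty closed set $F\subseteq X$ the restriction $f|_F$ has a point of continuity. A transfinite sequence $(U_\xi:\xi\in[0,\alpha])$ (with $\alpha$ an ordinal) of subsets of $X$ is regular in $X$ if: (a) each $U_\xi$ is open in $X$; (b) $\emptyset=U_0\subset U_1\subset U_2\subset\dots\subset U_\alpha=X$ (strictly increasing); (c) $U_\gamma=\bigcup_{\xi<\gamma}U_\xi$ for every limit ordinal $\gamma\le\alpha$. For $\xi\in[0,\alpha)$ put $P_{\xi+1}=U_{\xi+1}\setminus U_\xi$. The partition $(P_{\xi+1}:\xi\in[0,\alpha))$ of $X$ is called the regular partition associated with $(U_\xi)$; a regular partition of $X$ is a partition arising in this way. A family $\mathscr B$ of subsets of $X$ is a base for $f:X\to Y$ if for every open $V\subseteq Y$ there exists a subfamily $\mathscr B_V\subseteq\mathscr B$ with $f^{-1}(V)=\bigcup_{B\in\mathscr B_V}B$. A map $f:X\to Y$ is $\sigma$-regular if there exists a sequence $(\mathscr P_n)_{n\in\omega}$ of regular partitions of $X$ such that $\bigcup_{n\in\omega}\mathscr P_n$ is a base for $f$. *)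

(* Defs.v *)
From HB Require Import structures.
From mathcomp Require Import all_boot all_order all_algebra.
From mathcomp Require Import all_classical wochoice.
From mathcomp Require Import topology.

Set Implicit Arguments.
Unset Strict Implicit.
Unset Printing Implicit Defensive.

Local Open Scope classical_set_scope.
Local Open Scope order_scope.

Definition baire_space (T : topologicalType) : Prop :=
  forall U : nat -> set T,
    (forall n, open (U n) /\ dense (U n)) -> dense (\bigcap_n U n).

(* A set F coerces to the type of its elements, which carries the topology
   induced by X (and not to [subspace F], whose points still range over X). *)
Definition hereditarily_baire (X : topologicalType) : Prop :=
  forall F : set X, closed F -> baire_space F.

(* [sigL F f : F -> Y] is the restriction of f to F. *)
Definition barely_continuous (X Y : topologicalType) (f : X -> Y) : Prop :=
  forall F : set X, closed F -> F !=set0 ->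
    exists x : F, {for x, continuous (sigL F f)}.

(* The set of ordinals [0, alpha] is rendered as a well-ordered type W with a
   greatest element: \bot is 0 and \top is alpha.  Up to isomorphism these are
   exactly the intervals [0, alpha]. *)
Definition is_succ d (W : tbOrderType d) (xi eta : W) : Prop :=
  xi < eta /\ forall z : W, ~~ (xi < z < eta).

Definition is_limit d (W : tbOrderType d) (gamma : W) : Prop :=
  gamma <> \bot /\ forall xi : W, ~ is_succ xi gamma.

Record regular_sequence (X : topologicalType) d (W : tbOrderType d)
    (U : W -> set X) : Prop := RegularSequence {
  regular_open : forall xi, open (U xi) ;
  regular_bot : U \bot = set0 ;
  regular_top : U \top = setT ;
  regular_increasing : forall xi eta, xi < eta -> U xi `<` U eta ;
  regular_limit : forall gamma, is_limit gamma ->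
    U gamma = \bigcup_(xi in [set xi | xi < gamma]) U xi
}.

(* The pieces are indexed by pairs (xi, xi + 1); every xi < alpha has a
   successor in [0, alpha]. *)
Definition associated_partition (X : topologicalType) d (W : tbOrderType d)
    (U : W -> set X) : set (set X) :=
  [set P | exists xi eta : W, is_succ xi eta /\ P = U eta `\` U xi].

Definition regular_partition (X : topologicalType) (P : set (set X)) : Prop :=
  exists (d : Order.disp_t) (W : tbOrderType d) (U : W -> set X),
    [/\ well_order (<=%O : rel W), regular_sequence U
      & P = associated_partition U].

Definition base_for (X Y : topologicalType) (f : X -> Y)
    (B : set (set X)) : Prop :=
  forall V : set Y, open V ->
    exists BV : set (set X), BV `<=` B /\ f @^-1` V = \bigcup_(A in BV) A.

Definition sigma_regular (X Y : topologicalType) (f : X -> Y) : Prop :=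
  exists P : nat -> set (set X),
    (forall n, regular_partition (P n)) /\ base_for f (\bigcup_n P n).

(* Main.v *)
Require Import Defs.
From mathcomp Require Import all_boot all_order all_algebra.
From mathcomp Require Import all_classical.
From mathcomp Require Import topology.

(** A regular partition restricted to any topological space T has pieces whose
    interiors have a dense union: if xi is the least index such that U_xi meets
    a given nonempty open set O, then xi = eta + 1 is a successor, O misses
    U_eta, and so O meets the piece U_xi \ U_eta in a nonempty open set.  When
    T = F is closed and nonempty, the Baire property yields a point x lying, for
    every n, in the interior of a piece of the n-th partition.  As the pieces of
    each partition are disjoint, every base element containing x is a
    neighbourhood of x in F, so the restriction to F is continuous at x. *)

Import Order.TTheory.

Local Open Scope classical_set_scope.
Local Open Scope order_scope.

Lemma well_order_min {d} {W : porderType d} {A : set W} :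
  wochoice.well_order (<=%O : rel W) -> A !=set0 ->
  exists2 m, A m & forall z, z < m -> ~ A z.
Proof.
move=> wo [a Aa].
have [|m [[mA mlb] _]] := wo [pred z | `[< A z >]].
  by exists a; rewrite inE.
exists m; first by move: mA; rewrite inE.
move=> z zm Az; have: m <= z by apply: mlb; rewrite inE.
by move=> /(lt_le_trans zm); rewrite ltxx.
Qed.

Lemma is_succ_le {d} {W : tbOrderType d} {xi eta z : W} :
  is_succ xi eta -> xi < z -> eta <= z.
Proof.
move=> [_ gap] xz; rewrite leNgt; apply/negP => ze.
by move: (gap z); rewrite xz ze.
Qed.

Section RegularPartition.
Context {X : topologicalType} {P : set (set X)}.
Hypothesis regP : regular_partition P.

(** A point determines its piece: the lower index is the greatest [xi] with [x] outside [U xi], and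
    the upper index is its unique successor. *)
Lemma regular_partition_disjoint (A B : set X) (x : X) :
  P A -> P B -> A x -> B x -> A = B.
Proof.
have [d [W [U [_ regU ->]]]] := regP.
have key xi eta xi' : is_succ xi eta -> U eta x -> ~ U xi' x ->
    ~ (xi < xi').
  move=> s Ux nUx /(is_succ_le s).
  rewrite le_eqVlt => /predU1P[e|lt]; first by apply: nUx; rewrite -e.
  by apply: nUx; have [+ _] := regular_increasing regU lt; apply.
move=> [xi [eta [s ->]]] [xi' [eta' [s' ->]]] [Ux nUx] [Ux' nUx'].
have exi : xi = xi'.
  have [lt|lt|//] := ltgtP xi xi'.
  - by case: (key _ _ _ s Ux nUx').
  - by case: (key _ _ _ s' Ux' nUx).
rewrite exi in s *; congr (U _ `\` _); apply/eqP; rewrite eq_le.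
by rewrite (is_succ_le s) ?(is_succ_le s')//; [case: s|case: s'].
Qed.

(** Working through [g] avoids a regular sequence on [T]: the preimages of the [U xi] need not
    increase strictly. *)
Lemma regular_partition_dense_interior (T : topologicalType) (g : T -> X) :
  continuous g -> dense (\bigcup_(A in P) (g @^-1` A)°).
Proof.
have [d [W [U [wo regU ->]]]] := regP => cg O [t Ot] oO.
have gU xi : open (g @^-1` U xi).
  by apply: open_comp (regular_open regU xi) => u _; exact: cg.
have [|xi [u [Ou Uu]] xi_min] :=
    well_order_min (A := [set xi | O `&` g @^-1` U xi !=set0]) wo.
  by exists \top, t; split => //=; rewrite (regular_top regU).
(* [U xi] contains a point, so [xi] is not [\bot]; at a limit, that point would lie in an earlier
   [U z], against minimality. *)
have /existsNP[eta /contrapT s] : ~ forall eta, ~ is_succ eta xi.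
  move=> nsucc; have xi0 : xi <> \bot.
    by move=> e; move: Uu; rewrite /= e (regular_bot regU).
  move: Uu; rewrite /= (regular_limit regU (conj xi0 nsucc)) => -[z zxi Uz].
  by apply: (xi_min z) => //; exists u.
exists u; split=> //; exists (U xi `\` U eta); first by exists eta, xi.
apply: (@filterS _ _ _ (O `&` g @^-1` U xi)); last first.
  by apply: open_nbhs_nbhs; split=> //; exact: openI.
move=> v [Ov Uv]; split=> // Uv'.
by apply: (xi_min eta); [case: s|exists v].
Qed.

End RegularPartition.

Theorem proposition4p11 (X Y : topologicalType) (f : X -> Y)
  (hX : hereditarily_baire X) (hf : sigma_regular f) :
  barely_continuous f.
Proof.
have [P [regP baseP]] := hf; move=> F cF [a Fa].
have cval : continuous (set_val : F -> X) by exact: initial_continuous.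
pose G n : set F := \bigcup_(A in P n) (set_val @^-1` A)°.
have denseG : dense (\bigcap_n G n).
  apply: hX cF _ _ => n; split; last exact: regular_partition_dense_interior.
  by apply: bigcup_open => A _; exact: open_interior.
have [||x [_ Gx]] := denseG setT; [|exact: openT|].
  by exists (exist _ a (mem_set Fa)).
exists x => V; rewrite /= nbhsE => -[V' [oV' V'x] V'V].
have [BV [BVP fV']] := baseP _ oV'.
have : (f @^-1` V') (set_val x) by [].
rewrite fV' => -[B BVB Bx].
have [n _ PB] := BVP _ BVB.
(* The index [n] is dictated by [B], so [x] must be good for all partitions at once. *)
have [A PA intA] := Gx n I.
have AB : A = B.
  have Ax : A (set_val x) := interior_subset intA.
  exact: (regular_partition_disjoint (regP n) _ _ _ PA PB Ax Bx).
apply: filterS intA => y Ay; apply: V'V.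
by have : (f @^-1` V') (set_val y) by rewrite fV'; exists B => //; rewrite -AB.
Qed.
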